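(* Let $(\mathcal{M},g)$ be a $C^2$ spacetime with boundary $\Sigma$ such that $\Sigma$ is null at at least one point, i.e. $\Sigma_0\neq\emptyset$ (in particular, $\Sigma$ may be a signature-changing boundary). Let $(\mathcal{M}^{+},g^{+})$ and $(\mathcal{M}^{-},g^{-})$ be two identical copies of $(\mathcal{M},g)$, and let $\Phi:\Sigma^-\to\Sigma^+$ be the natural identification of their boundaries (each point of $\Sigma$ in one copy is identified with the same point of $\Sigma$ in the other copy). Then $(\mathcal{M}^+,g^+)$ and $(\mathcal{M}^-,g^-)$ cannot be matched continuously via $\Phi$; that is, it is impossible to join the two copies through $\Phi$ so as to produce a bulk with continuous metric.
   Context: A $C^2$ spacetime (with boundary) is a $C^3$ manifold (with $C^3$ boundary) of dimension $n\ge 2$ endowed with a $C^2$ Lorentzian metric of signature $(-,+,\dots,+)$, defined up to and including the boundary. Null points: let $\Sigma$ be the boundary and $\boldsymbol{N}$ a nowhere zero one-form along $\Sigma$ annihilating all vectors tangent to $\Sigma$ (normal one-form). $\Sigma_0=\{p\in\Sigma: g^{\mu\nu}N_\mu N_\nu|_p=0\}$ is the set of points where $\Sigma$ is null (equivalently, where the first fundamental form, the pull-back of $g$ to $\Sigma$, is degenerate). Continuous matching: two $C^2$ spacetimes with boundary $(\mathcal{M}^\pm,g^\pm)$, with boundaries $\Sigma^\pm$, are matched continuously via a diffeomorphism $\Phi:\Sigma^-\to\Sigma^+$ if the space $\mathcal{M}=\mathcal{M}^+\cup_\Phi\mathcal{M}^-$, obtained by identifying each $p\in\Sigma^-$ with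 $\Phi(p)\in\Sigma^+$, carries a $C^3$ differentiable structure (inducing the given ones on $\mathcal{M}^\pm$, which lie on opposite sides of the common hypersurface) and a continuous Lorentzian metric $g$ which coincides with $g^+$ on $\mathcal{M}^+$ and with $g^-$ on $\mathcal{M}^-$. *)

(* Defs.v *)
From HB Require Import structures.
From mathcomp Require Import all_boot all_order all_algebra generic_quotient.
From mathcomp Require Import all_classical all_reals all_analysis.

Set Implicit Arguments.
Unset Strict Implicit.
Unset Printing Implicit Defensive.

Import Order.TTheory GRing.Theory Num.Theory.
Import numFieldNormedType.Exports.

Local Open Scope classical_set_scope.
Local Open Scope ring_scope.
Local Open Scope quotient_scope.

(* The intended use is with [U] open. *)
Fixpoint Ck_open (R : realType) (V W : normedModType R) (k : nat) (f : V -> W)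
    (U : set V) : Prop :=
  match k with
  | 0 => {in U, continuous f}
  | k'.+1 => (forall x, U x -> differentiable f x) /\
             (forall v, Ck_open k' (fun x => 'd f x v) U)
  end.

(* [C^k] on an arbitrary subset [A]: locally the restriction of a [C^k] function
   defined on an open set.  For [A] relatively open in a half-space this is
   [C^k] up to and including the boundary. *)
Definition Ck_on (R : realType) (V W : normedModType R) (k : nat) (f : V -> W)
    (A : set V) : Prop :=
  forall x, A x -> exists U F,
    [/\ open U, U x, Ck_open k F U & forall y, A y -> U y -> F y = f y].

(* The Jacobian at [x] of a function known on [A] only, through a local
   extension (it is unique when [A] is a neighbourhood of [x] in [R^n] or in a
   closed half-space).  The library acts on row vectors: the differential is
   [v |-> v *m J]. *)
Definition is_jacobian_on (R : realType) (m n : nat) (A : set 'rV[R]_m)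
    (f : 'rV[R]_m -> 'rV[R]_n) (x : 'rV[R]_m) (J : 'M[R]_(m, n)) : Prop :=
  exists F, [/\ differentiable F x,
                \forall y \near x, A y -> F y = f y
              & J = jacobian F x].

(* The first coordinate of 'rV_n is the one of index 0; these sets are the
   expected ones for [0 < n]. *)
Definition halfspace (R : realType) (n : nat) : set 'rV[R]_n :=
  [set x | forall i : 'I_n, i = 0%N :> nat -> 0 <= x 0 i].
Definition opp_halfspace (R : realType) (n : nat) : set 'rV[R]_n :=
  [set x | forall i : 'I_n, i = 0%N :> nat -> x 0 i <= 0].
Definition hyperplane (R : realType) (n : nat) : set 'rV[R]_n :=
  [set x | forall i : 'I_n, i = 0%N :> nat -> x 0 i = 0].

(* [chart_map] is meaningful on [chart_dom], [chart_inv] on [chart_map @` chart_dom]. *)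
Record chart (R : realType) (n : nat) (T : topologicalType) := Chart {
  chart_dom : set T;
  chart_map : T -> 'rV[R]_n;
  chart_inv : 'rV[R]_n -> T }.

(* [c] is a homeomorphism from an open set of [T] onto a relatively open set of
   the model space [H] (all of [R^n], or the half-space). *)
Definition is_chart (R : realType) (n : nat) (T : topologicalType)
    (H : set 'rV[R]_n) (c : chart R n T) : Prop :=
  [/\ open (chart_dom c),
      exists2 O, open O & chart_map c @` chart_dom c = O `&` H,
      {in chart_dom c, cancel (chart_map c) (chart_inv c)},
      {within chart_dom c, continuous (chart_map c)}
    & {within chart_map c @` chart_dom c, continuous (chart_inv c)}].

Definition compatible (R : realType) (n : nat) (T : topologicalType) (k : nat)
    (c d : chart R n T) : Prop :=
  Ck_on k (chart_map d \o chart_inv c) (chart_map c @` (chart_dom c `&` chart_dom d)) /\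
  Ck_on k (chart_map c \o chart_inv d) (chart_map d @` (chart_dom c `&` chart_dom d)).

(* A [C^k] differentiable structure modelled on [H]: a maximal [C^k] atlas. *)
Record Ck_structure (R : realType) (n : nat) (k : nat) (H : set 'rV[R]_n)
    (T : topologicalType) := CkStructure {
  atlas : set (chart R n T);
  atlas_chart : forall c, atlas c -> is_chart H c;
  atlas_cover : forall p, exists2 c, atlas c & chart_dom c p;
  atlas_compatible : forall c d, atlas c -> atlas d -> compatible k c d;
  atlas_maximal : forall c, is_chart H c ->
    (forall d, atlas d -> compatible k c d) -> atlas c }.

Definition boundary (R : realType) (n k : nat) (T : topologicalType)
    (X : Ck_structure k (@halfspace R n) T) : set T :=
  [set p | exists c, [/\ atlas X c, chart_dom c p & hyperplane (chart_map c p)]].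

(* Coordinate expression of [f], and the set on which it represents the
   restriction of [f] to [S]. *)
Definition local_rep (R : realType) (n m : nat) (T T' : topologicalType)
    (f : T -> T') (c : chart R n T) (d : chart R m T') : 'rV[R]_n -> 'rV[R]_m :=
  chart_map d \o f \o chart_inv c.
Definition local_dom (R : realType) (n m : nat) (T T' : topologicalType)
    (S : set T) (f : T -> T') (c : chart R n T) (d : chart R m T') :
    set 'rV[R]_n :=
  chart_map c @` (S `&` chart_dom c `&` f @^-1` chart_dom d).

(* For [S] the boundary of a manifold this is [C^k] smoothness on the hypersurface
   [S]: by [Ck_on], expressions on [hyperplane] are tested through extensions. *)
Definition Ck_map (R : realType) (n m : nat) (T T' : topologicalType)
    (k kT kT' : nat) (H : set 'rV[R]_n) (H' : set 'rV[R]_m)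
    (X : Ck_structure kT H T) (Y : Ck_structure kT' H' T')
    (S : set T) (f : T -> T') : Prop :=
  {within S, continuous f} /\
  forall c d, atlas X c -> atlas Y d -> Ck_on k (local_rep f c d) (local_dom S f c d).

Definition Ck_diffeo (R : realType) (n m : nat) (T T' : topologicalType)
    (k kT kT' : nat) (H : set 'rV[R]_n) (H' : set 'rV[R]_m)
    (X : Ck_structure kT H T) (Y : Ck_structure kT' H' T')
    (S : set T) (S' : set T') (f : T -> T') : Prop :=
  f @` S = S' /\
  exists g : T' -> T,
    [/\ {in S, cancel f g}, Ck_map k X Y S f & Ck_map k Y X S' g].

(* Signature (-,+,...,+): the rows of [P] are an orthonormal basis with the first
   vector timelike. *)
Definition lorentzian (R : realType) (n : nat) (G : 'M[R]_n) : Prop :=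
  G^T = G /\
  exists2 P : 'M[R]_n, P \in unitmx &
    P *m G *m P^T = diag_mx (\row_(i < n) (if i == 0%N :> nat then -1 else 1)).

(* A covariant 2-tensor field is given by its components [g c p] in each chart
   [c] at each [p] in [chart_dom c]; [pulls_back X Y f gX gY] says [f^* gY = gX]. *)
Definition pulls_back (R : realType) (n m : nat) (T T' : topologicalType)
    (kT kT' : nat) (H : set 'rV[R]_n) (H' : set 'rV[R]_m)
    (X : Ck_structure kT H T) (Y : Ck_structure kT' H' T') (f : T -> T')
    (gX : chart R n T -> T -> 'M[R]_n) (gY : chart R m T' -> T' -> 'M[R]_m) :
    Prop :=
  forall c d p J, atlas X c -> atlas Y d -> chart_dom c p -> chart_dom d (f p) ->
    is_jacobian_on (local_dom setT f c d) (local_rep f c d) (chart_map c p) J ->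
    gX c p = J *m gY d (f p) *m J^T.

(* A Lorentzian metric of class [C^r]; [metric_change] is the tensorial change of
   components between charts. *)
Record lorentzian_metric (R : realType) (n k r : nat) (H : set 'rV[R]_n)
    (T : topologicalType) (X : Ck_structure k H T) := LorentzianMetric {
  metric_comp :> chart R n T -> T -> 'M[R]_n;
  metric_lorentzian : forall c p, atlas X c -> chart_dom c p -> lorentzian (metric_comp c p);
  metric_change : pulls_back X X idfun metric_comp metric_comp;
  metric_Cr : forall c, atlas X c ->
    Ck_on r (fun x => metric_comp c (chart_inv c x)) (chart_map c @` chart_dom c) }.

(* A [C^2] spacetime with boundary; the bound [2 <= n] on the dimension is put on
   statements. *)
Record spacetime (R : realType) (n : nat) := Spacetime {
  carrier :> topologicalType;
  st_hausdorff : hausdorff_space carrier;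
  st_second_countable : @second_countable carrier;
  st_structure : Ck_structure 3 (@halfspace R n) carrier;
  st_metric : lorentzian_metric 2 st_structure }.

Definition Sigma (R : realType) (n : nat) (M : spacetime R n) : set M :=
  boundary (st_structure M).
Arguments Sigma {R n} M.

(* [N] is nonzero and annihilates the vectors tangent to the boundary, in a chart
   in which the latter is [hyperplane]. *)
Definition is_normal_covector (R : realType) (n : nat) (N : 'rV[R]_n) : Prop :=
  N <> 0 /\ forall v : 'rV[R]_n, hyperplane v -> N *m v^T = 0.

(* The points of the boundary at which [g^{mu nu} N_mu N_nu = 0]; only the value
   of the normal one-form at the point matters. *)
Definition Sigma0 (R : realType) (n : nat) (M : spacetime R n) : set M :=
  [set p | exists c N,
    [/\ atlas (st_structure M) c, chart_dom c p, hyperplane (chart_map c p),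
        is_normal_covector N
      & N *m invmx (st_metric M c p) *m N^T = 0]].
Arguments Sigma0 {R n} M.

Section adjunction.
Variables (X Y : topologicalType) (S : set X) (f : X -> Y).

Definition adj_side (b : bool) : topologicalType := if b then Y else X.

Definition adj_attach (a : {b & adj_side b}) : {b & adj_side b} :=
  match a with
  | existT true _ => a
  | existT false x => if x \in S then existT adj_side true (f x) else a
  end.

(* This is the equivalence relation generated by [x ~ f x] for [x] in [S]. *)
Definition adj_rel (a b : {b & adj_side b}) : bool :=
  adj_attach a == adj_attach b.

Lemma adj_rel_refl : reflexive adj_rel.
Proof. by move=> a; rewrite /adj_rel. Qed.
Lemma adj_rel_sym : symmetric adj_rel.
Proof. by move=> a b; rewrite /adj_rel eq_sym. Qed.
Lemma adj_rel_trans : transitive adj_rel.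
Proof. by move=> b a c; rewrite /adj_rel => /eqP-> /eqP->. Qed.

Definition adj_equiv := EquivRel _ adj_rel_refl adj_rel_sym adj_rel_trans.

(* The disjoint union of [X] and [Y] with each [x] in [S] identified with [f x],
   with the quotient topology. *)
Definition adjunction := {eq_quot adj_equiv}.
HB.instance Definition _ :=
  Topological.copy adjunction (quotient_topology adjunction).
HB.instance Definition _ := Quotient.on adjunction.

Definition adj_inl (x : X) : adjunction := \pi_adjunction (existT adj_side false x).
Definition adj_inr (y : Y) : adjunction := \pi_adjunction (existT adj_side true y).
End adjunction.

(* Only the restriction of [bd_fun] to the boundary is meaningful. *)
Record boundary_diffeo (R : realType) (n : nat) (Mm Mp : spacetime R n) :=
  BoundaryDiffeo {
    bd_fun :> Mm -> Mp;
    bd_diffeo : Ck_diffeo 3 (st_structure Mm) (st_structure Mp)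
                  (Sigma Mm) (Sigma Mp) bd_fun }.

Lemma Ck_map_idfun (R : realType) (n k : nat) (T : topologicalType)
    (H : set 'rV[R]_n) (X : Ck_structure k H T) (S : set T) :
  Ck_map k X X S idfun.
Proof.
split; first by apply: continuous_subspaceT => x; exact: cvg_id.
move=> c d Xc Xd x [p [[Sp cp] dp] <-].
have [/(_ (chart_map c p)) + _] := atlas_compatible Xc Xd.
case=> [|U [F [oU Ux CF FE]]]; first by exists p.
exists U, F; split=> // y [q [[Sq cq] dq] <-] Uy.
by apply: FE => //; exists q.
Qed.

Lemma Sigma_idfun_diffeo (R : realType) (n : nat) (M : spacetime R n) :
  Ck_diffeo 3 (st_structure M) (st_structure M) (Sigma M) (Sigma M) idfun.
Proof.
split; first by rewrite image_id.
by exists idfun; split => //; exact: Ck_map_idfun.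
Qed.

Definition natural_identification (R : realType) (n : nat)
    (M : spacetime R n) : boundary_diffeo M M :=
  BoundaryDiffeo (Sigma_idfun_diffeo M).

Definition glued (R : realType) (n : nat) (Mm Mp : spacetime R n)
    (Phi : boundary_diffeo Mm Mp) : topologicalType :=
  adjunction (Sigma Mm) Phi.
Definition from_minus (R : realType) (n : nat) (Mm Mp : spacetime R n)
    (Phi : boundary_diffeo Mm Mp) : Mm -> glued Phi :=
  @adj_inl Mm Mp (Sigma Mm) Phi.
Definition from_plus (R : realType) (n : nat) (Mm Mp : spacetime R n)
    (Phi : boundary_diffeo Mm Mp) : Mp -> glued Phi :=
  @adj_inr Mm Mp (Sigma Mm) Phi.

(* Near each point of the common hypersurface there are coordinates in which the
   plus side is the half-space where the first coordinate is nonnegative and the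
   minus side the one where it is nonpositive. *)
Definition opposite_sides (R : realType) (n : nat) (Mm Mp : spacetime R n)
    (Phi : boundary_diffeo Mm Mp)
    (D : Ck_structure 3 (@setT 'rV[R]_n) (glued Phi)) : Prop :=
  forall p : Mp, Sigma Mp p -> exists e, [/\ atlas D e, chart_dom e (from_plus Phi p),
    chart_dom e `&` range (from_plus Phi) = chart_dom e `&` chart_map e @^-1` (@halfspace R n)
  & chart_dom e `&` range (from_minus Phi) =
      chart_dom e `&` chart_map e @^-1` (@opp_halfspace R n)].

(* The bulk is a manifold without boundary (model space [setT]); it induces the
   given differentiable structures when the inclusions of the two sides are
   diffeomorphisms onto their images. *)
Definition matched_continuously (R : realType) (n : nat)
    (Mm Mp : spacetime R n) (Phi : boundary_diffeo Mm Mp) : Prop :=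
  exists (D : Ck_structure 3 (@setT 'rV[R]_n) (glued Phi))
         (g : lorentzian_metric 0 D),
    [/\ Ck_diffeo 3 (st_structure Mm) D setT (range (from_minus Phi))
          (from_minus Phi)
        /\ Ck_diffeo 3 (st_structure Mp) D setT (range (from_plus Phi))
          (from_plus Phi),
        opposite_sides D,
        pulls_back (st_structure Mm) D (from_minus Phi) (st_metric Mm) g
      & pulls_back (st_structure Mp) D (from_plus Phi) (st_metric Mp) g].

(* Main.v *)
(* At a null point of the boundary the null direction [u = N G^-1] is tangent
   and orthogonal to the boundary.  In a bulk chart adapted to the common
   hypersurface, continuity of the metric gives [G = J E J^T] for the Jacobian [J]
   of either inclusion, with a single [E].  Both inclusions agree on the boundary,
   hence send [u] to the same vector, whose dual under [E] is [(y, 0, .., 0)], a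
   multiple of the normal one-form; pulling back gives [y * J 0 0 = N 0 0 <> 0]
   on both sides.  So the transversal entries [J 0 0] are equal and nonzero; but
   the inward directions point to opposite sides, so one entry is nonnegative and
   the other nonpositive. *)
Require Import Defs.
From mathcomp Require Import all_boot all_order all_algebra generic_quotient.
From mathcomp Require Import all_classical all_reals all_analysis.

Set Implicit Arguments.
Unset Strict Implicit.
Unset Printing Implicit Defensive.

Import Order.TTheory GRing.Theory Num.Theory.
Import numFieldNormedType.Exports.

Local Open Scope classical_set_scope.
Local Open Scope ring_scope.

(** * Linear algebra of the normal covector at a null point *)

Lemma hyperplane_ordP (R : realType) (n : nat) (v : 'rV[R]_n.+1) :
  hyperplane v <-> v 0 0 = 0.
Proof.
split=> [/(_ ord0 erefl)//|v0 i i0].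
by rewrite (_ : i = 0)//; apply: val_inj.
Qed.

Lemma lorentzian_unitmx (R : realType) (n : nat) (G : 'M[R]_n) :
  lorentzian G -> G \in unitmx.
Proof.
move=> [_ [P _ PGP]].
have : P *m G *m P^T \in unitmx.
  rewrite PGP unitmxE det_diag unitfE; apply/prodf_neq0 => i _.
  by rewrite mxE; case: ifP => _; rewrite ?oppr_eq0 oner_eq0.
by rewrite !unitmx_mul => /andP[/andP[]].
Qed.

Lemma normal_covectorE (R : realType) (n : nat) (N : 'rV[R]_n.+1) :
  is_normal_covector N -> N = N 0 0 *: delta_mx 0 0 /\ N 0 0 != 0.
Proof.
move=> [N0 NH].
have NE : N = N 0 0 *: delta_mx 0 0.
  apply/rowP => j; rewrite !mxE eqxx /=; have [->|j0] := eqVneq j 0.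
    by rewrite mulr1.
  have /NH/rowP/(_ 0) : hyperplane (delta_mx 0 j : 'rV[R]_n.+1).
    by apply/hyperplane_ordP; rewrite mxE eqxx/= eq_sym (negPf j0).
  rewrite trmx_delta mxE (bigD1 j)//= big1 => [|k kj].
    by rewrite !mxE !eqxx mulr1 addr0 mulr0.
  by rewrite mxE (negPf kj) mulr0.
by split=> //; apply/eqP => N00; apply: N0; rewrite NE N00 scale0r.
Qed.

(** Dual form of tangency: the entries [J j 0] with [j != 0] are first coordinates of images of
    tangent basis vectors, so they vanish and the conormal direction is only rescaled. *)
Lemma hyperplane_preserving_col0 (R : realType) (n : nat) (J : 'M[R]_n.+1) :
  (forall v, hyperplane v -> hyperplane (v *m J)) ->
  (delta_mx 0 0 : 'rV[R]_n.+1) *m J^T = J 0 0 *: delta_mx 0 0.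
Proof.
move=> JH; rewrite -rowE; apply/rowP => j; rewrite !mxE eqxx/=.
have [->|j0] := eqVneq j 0; first by rewrite mulr1.
rewrite mulr0; have : hyperplane (delta_mx 0 j : 'rV[R]_n.+1).
  by apply/hyperplane_ordP; rewrite mxE eqxx/= eq_sym (negPf j0).
by move=> /JH/hyperplane_ordP; rewrite -rowE mxE.
Qed.

Lemma null_normal_entry (R : realType) (n : nat) (G E J : 'M[R]_n.+1)
    (N : 'rV[R]_n.+1) :
  G \in unitmx -> is_normal_covector N -> G = J *m E *m J^T ->
  (forall v, hyperplane v -> hyperplane (v *m J)) ->
  J 0 0 * (N *m invmx G *m J *m E) 0 0 = N 0 0.
Proof.
move=> Gu Nn GE JH; have [NE _] := normal_covectorE Nn.
have Ju : J^T \in unitmx by move: Gu; rewrite GE unitmx_mul => /andP[].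
set y := _ *m E.
have yJ : y *m J^T = N by rewrite /y -!mulmxA mulmxA (mulmxA J) -GE mulmxKV.
(* Both sides have image [J 0 0 * N 0 0] times the basis covector under the invertible [J^T]. *)
have : J 0 0 *: y = N 0 0 *: delta_mx 0 0.
  apply: (can_inj (mulmxK Ju)).
  by rewrite -!scalemxAl yJ (hyperplane_preserving_col0 JH) [in LHS]NE !scalerA mulrC.
by move=> /rowP/(_ 0); rewrite !mxE !eqxx mulr1.
Qed.

Lemma null_transversal_entry (R : realType) (n : nat) (G E Jm Jp : 'M[R]_n.+1)
    (N : 'rV[R]_n.+1) :
  G \in unitmx -> is_normal_covector N -> N *m invmx G *m N^T = 0 ->
  G = Jm *m E *m Jm^T -> G = Jp *m E *m Jp^T ->
  (forall v, hyperplane v -> v *m Jm = v *m Jp) ->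
  (forall v, hyperplane v -> hyperplane (v *m Jp)) ->
  Jm 0 0 = Jp 0 0 /\ Jp 0 0 != 0.
Proof.
move=> Gu Nn Nnull Gm Gp JmJp JpH; have [NE N00] := normal_covectorE Nn.
have JmH v : hyperplane v -> hyperplane (v *m Jm).
  by move=> hv; rewrite JmJp//; exact: JpH.
(* The null condition reads [N 0 0 * u 0 0 = 0] for [u = N G^-1], so [u] is tangent and the two
   Jacobians agree on it. *)
have /JmJp uJ : hyperplane (N *m invmx G).
  apply/hyperplane_ordP; apply: (mulfI N00); rewrite mulr0.
  move/matrixP/(_ 0 0): Nnull; rewrite {2}NE linearZ/= -scalemxAr trmx_delta -colE.
  by rewrite !mxE.
have := null_normal_entry Gu Nn Gm JmH.
have := null_normal_entry Gu Nn Gp JpH.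
rewrite uJ; set y := (_ *m E) 0 0 => pE mE.
have y0 : y != 0 by apply: contraNneq N00 => y0; rewrite -pE y0 mulr0.
split; first by apply: (mulIf y0); rewrite pE mE.
by apply: contraNneq N00 => p0; rewrite -pE p0 mul0r.
Qed.

(** * One-sided derivatives along rays *)

Lemma ray_cvg (R : realType) (V : normedModType R) (x v : V) :
  t *: v + x @[t --> 0^'+] --> x.
Proof.
rewrite -[X in _ --> X]add0r -[X in _ --> X + _](scale0r v).
apply: cvg_at_right_filter; apply: cvgD; last exact: cvg_cst.
by apply: cvgZr_tmp; exact: cvg_id.
Qed.

(** The extension that defines [J] agrees with [f] on a ray staying in [A], so [v *m J] depends on
    [f] alone. This makes Jacobians obtained from unrelated extensions comparable. *)
Lemma is_jacobian_on_cvg (R : realType) (m n : nat) (A : set 'rV[R]_m)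
    (f : 'rV[R]_m -> 'rV[R]_n) (x v : 'rV[R]_m) (J : 'M[R]_(m, n)) :
  is_jacobian_on A f x J -> A x -> (\forall t \near 0^'+, A (t *: v + x)) ->
  t^-1 *: (f (t *: v + x) - f x) @[t --> 0^'+] --> v *m J.
Proof.
move=> [F [dF Ff ->]] Ax Av.
have Fx : F x = f x by have := nbhs_singleton Ff; exact.
rewrite -deriveEjacobian//.
have /cvg_dnbhs_at_right := @diff_derivable _ _ _ F x v dF.
apply: cvg_trans; apply: near_eq_cvg.
have {}Ff : \forall t \near 0^'+,
    A (t *: v + x) -> F (t *: v + x) = f (t *: v + x).
  exact: ray_cvg Ff.
near=> t; rewrite /= Fx (near Ff t)//; near: t; exact: Av.
Unshelve. all: by end_near. Qed.

(** The difference quotients have a constant sign because coordinate [i] of [f] vanishes at [x], and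
    the limit keeps it. The factor [s], taken as 1 or -1, lets one statement serve both sides. *)
Lemma is_jacobian_on_row_ge0 (R : realType) (m n : nat) (A : set 'rV[R]_m)
    (f : 'rV[R]_m -> 'rV[R]_n) (x v : 'rV[R]_m) (J : 'M[R]_(m, n)) (s : R) i :
  is_jacobian_on A f x J -> A x -> (\forall t \near 0^'+, A (t *: v + x)) ->
  f x 0 i = 0 -> (\forall t \near 0^'+, 0 <= s * f (t *: v + x) 0 i) ->
  0 <= s * (v *m J) 0 i.
Proof.
move=> Jf Ax Av fx0 fv0.
have cJ := is_jacobian_on_cvg Jf Ax Av.
have : s * (t^-1 *: (f (t *: v + x) - f x)) 0 i @[t --> 0^'+] --> s * (v *m J) 0 i.
  apply: cvgM; first exact: cvg_cst.
  by apply: (cvg_comp _ (fun w : 'rV[R]_n => w 0 i) cJ); exact: coord_continuous.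
move/cvgr_to_ge; apply; near=> t.
rewrite !mxE fx0 subr0 mulrCA mulr_ge0//; last by near: t.
by rewrite invr_ge0 ltW//; near: t; exact: nbhs_right_gt.
Unshelve. all: by end_near. Qed.

(** * Maps between manifolds read in charts *)

Section charts.
Context {R : realType} {n m : nat} {T T' : topologicalType}.
Context {H : set 'rV[R]_n} {H' : set 'rV[R]_m}.
Implicit Types (c : chart R n T) (d : chart R m T') (f : T -> T').

Lemma local_rep_chart f c d q : is_chart H c -> chart_dom c q ->
  local_rep f c d (chart_map c q) = chart_map d (f q).
Proof. by move=> [_ _ cK _ _] cq; rewrite /local_rep /= cK ?inE. Qed.

Lemma local_dom_near f c d p : is_chart H c -> is_chart H' d ->
  continuous f -> chart_dom c p -> chart_dom d (f p) ->
  \forall y \near chart_map c p, H y -> local_dom setT f c d y.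
Proof.
move=> [_ [ O oO cO] cK _ ciC] [od _ _ _ _] fC cp dfp.
have Ax : (chart_map c @` chart_dom c) (chart_map c p) by exists p.
have Ox : O (chart_map c p) by move: Ax; rewrite cO => -[].
have dnear : nbhs (chart_inv c (chart_map c p)) (f @^-1` chart_dom d).
  by rewrite cK ?inE//; apply: fC; exact: open_nbhs_nbhs.
move/subspace_continuousP : ciC => /(_ _ Ax) ciC.
have Anear : \forall y \near chart_map c p, (chart_map c @` chart_dom c) y ->
  chart_dom d (f (chart_inv c y)) by exact: ciC dnear.
near=> y => Hy; have Ay : (chart_map c @` chart_dom c) y.
  by rewrite cO; split=> //; near: y; exact: open_nbhs_nbhs.
have : chart_dom d (f (chart_inv c y)) by exact: (near Anear y).
by case: Ay => q cq <-; rewrite cK ?inE// => dq; exists q.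
Unshelve. all: by end_near. Qed.

Lemma local_dom_ray f c d p v : is_chart H c -> is_chart H' d ->
  continuous f -> chart_dom c p -> chart_dom d (f p) ->
  (forall t, 0 <= t -> H (t *: v + chart_map c p)) ->
  \forall t \near 0^'+, local_dom setT f c d (t *: v + chart_map c p).
Proof.
move=> cc dd fC cp dp Hv.
have Hn : \forall t \near 0^'+,
    H (t *: v + chart_map c p) -> local_dom setT f c d (t *: v + chart_map c p).
  exact: ray_cvg (local_dom_near cc dd fC cp dp).
near=> t; apply: (near Hn t) => //.
by apply: Hv; apply: ltW; near: t; exact: nbhs_right_gt.
Unshelve. all: by end_near. Qed.

Lemma Ck_map_jacobian (k kT kT' : nat) (X : Ck_structure kT H T)
    (Y : Ck_structure kT' H' T') f c d p :
  Ck_map k.+1 X Y setT f -> atlas X c -> atlas Y d -> chart_dom c p ->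
  chart_dom d (f p) -> exists J,
  is_jacobian_on (local_dom setT f c d) (local_rep f c d) (chart_map c p) J.
Proof.
move=> [_ fk] Xc Yd cp dp.
have [|U [F [oU Up [dF _] Ff]]] := fk _ _ Xc Yd (chart_map c p).
  by exists p.
exists (jacobian F (chart_map c p)), F; split=> //; first exact: dF.
near=> y => Ay; apply: Ff => //; near: y; exact: open_nbhs_nbhs.
Unshelve. all: by end_near. Qed.

End charts.

(** * Gluing and the contradiction at a null point *)

Lemma from_minus_plus (R : realType) (n : nat) (Mm Mp : spacetime R n)
    (Phi : boundary_diffeo Mm Mp) (q : Mm) :
  Sigma Mm q -> from_minus Phi q = from_plus Phi (Phi q).
Proof.
move=> Sq; apply/eqmodP; rewrite /= /adj_rel /=.
by rewrite mem_set.
Qed.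

Theorem corollary2 (R : realType) (n : nat) (hn : (2 <= n)%N)
  (M : spacetime R n) (hnull : Sigma0 M !=set0) :
  ~ matched_continuously (natural_identification M).
Proof.
case: n hn M hnull => // n _ M [p [c [N [Xc cp hp Nn Nnull]]]].
move=> [D [g [[[_ [_ [_ Cm _]]] [_ [_ [_ Cp _]]]] opp gm gp]]].
have Sc q : chart_dom c q -> hyperplane (chart_map c q) -> Sigma M q.
  by move=> cq hq; exists c.
have glue q : Sigma M q -> from_minus (natural_identification M) q =
  from_plus (natural_identification M) q by move/from_minus_plus.
have Sp := Sc _ cp hp.
have [e [De ep eplus eminus]] := opp p Sp.
have mC : continuous (from_minus (natural_identification M)).
  by apply/continuous_subspace_setT; case: Cm.
have pC : continuous (from_plus (natural_identification M)).
  by apply/continuous_subspace_setT; case: Cp.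
set fm := from_minus _ in glue Cm mC gm eminus.
set fp := from_plus _ in glue Cp pC gp eplus ep.
have em : chart_dom e (fm p) by rewrite glue.
have [Jm Jmf] := Ck_map_jacobian Cm Xc De cp em.
have [Jp Jpf] := Ck_map_jacobian Cp Xc De cp ep.
have cH := atlas_chart Xc; have eH := atlas_chart De.
set x := chart_map c p in hp Jmf Jpf.
set Am := local_dom _ fm c e in Jmf.
set Ap := local_dom _ fp c e in Jpf.
set rm := local_rep fm c e in Jmf.
set rp := local_rep fp c e in Jpf.
have x0 : x 0 0 = 0 by apply/hyperplane_ordP.
have Amx : Am x by exists p.
have Apx : Ap x by exists p.
(* In the adapted chart [e], lying in the image of a side is a sign condition on the first
   coordinate. *)
have rm_le0 y : Am y -> rm y 0 0 <= 0.
  move=> [q [[_ cq] eq] <-]; rewrite /rm (local_rep_chart _ _ cH cq).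
  have : (chart_dom e `&` range fm) (fm q) by split => //; exists q.
  by rewrite eminus => -[_ /(_ ord0 erefl)].
have rp_ge0 y : Ap y -> 0 <= rp y 0 0.
  move=> [q [[_ cq] eq] <-]; rewrite /rp (local_rep_chart _ _ cH cq).
  have : (chart_dom e `&` range fp) (fp q) by split => //; exists q.
  by rewrite eplus => -[_ /(_ ord0 erefl)].
have rmp y : hyperplane y -> Am y -> rm y = rp y.
  move=> hy [q [[_ cq] eq] qy]; rewrite -qy /rm /rp !(local_rep_chart _ _ cH cq).
  by rewrite glue//; apply: Sc => //; rewrite qy.
(* At a boundary point the two representatives coincide, so their first coordinate has both
   signs. *)
have rpx : rp x 0 0 = 0.
  by apply/eqP; rewrite eq_le rp_ge0// -rmp// rm_le0.
have rmx : rm x 0 0 = 0 by rewrite rmp.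
have hray v t : hyperplane v -> hyperplane (t *: v + x).
  by move=> /hyperplane_ordP v0; apply/hyperplane_ordP; rewrite !mxE v0 x0 mulr0 addr0.
have Hray (v : 'rV[R]_n.+1) : 0 <= v 0 0 ->
    forall t : R, 0 <= t -> halfspace (t *: v + x).
  move=> v0 t t0 i i0; rewrite (_ : i = 0); last exact: val_inj.
  by rewrite !mxE x0 addr0 mulr_ge0.
have Amray v v0 := local_dom_ray cH eH mC cp em (Hray v v0).
have Apray v v0 := local_dom_ray cH eH pC cp ep (Hray v v0).
(* A tangent ray stays in the hyperplane, where [rm] and [rp] agree; their difference quotients then
   have the same limit. *)
have JmJp v : hyperplane v -> v *m Jm = v *m Jp.
  move=> hv; have v0 : 0 <= v 0 0 by move/hyperplane_ordP : hv => ->.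
  have := is_jacobian_on_cvg Jmf Amx (Amray v v0).
  have := is_jacobian_on_cvg Jpf Apx (Apray v v0).
  move=> pcvg mcvg; apply/esym; apply: (cvg_unique _ pcvg) => //.
  apply: cvg_trans mcvg; apply: near_eq_cvg; near=> t.
  rewrite /= !rmp//; first exact: hray.
  by near: t; exact: Amray.
(* Along a tangent ray the first coordinate of [rp] is nonnegative, and nonpositive since it equals
   that of [rm]. *)
have JpH v : hyperplane v -> hyperplane (v *m Jp).
  move=> hv; apply/hyperplane_ordP.
  have v0 : 0 <= v 0 0 by move/hyperplane_ordP : hv => ->.
  have pos := is_jacobian_on_row_ge0 (s := 1) Jpf Apx (Apray v v0) rpx.
  have neg := is_jacobian_on_row_ge0 (s := (-1)) Jpf Apx (Apray v v0) rpx.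
  apply/eqP; rewrite eq_le -[X in (X <= _)]opprK oppr_le0 -mulN1r neg; last first.
    near=> t; rewrite mulN1r oppr_ge0 -rmp; first apply: rm_le0.
    - by near: t; exact: Amray.
    - exact: hray.
    - by near: t; exact: Amray.
  rewrite -[X in (_ <= X)]mul1r pos//.
  by near=> t; rewrite mul1r; apply: rp_ge0; near: t; exact: Apray.
(* The inward basis vector: its image under a Jacobian has first coordinate the entry [0 0]. *)
have e00 : 0 <= (delta_mx 0 0 : 'rV[R]_n.+1) 0 0 by rewrite mxE ler01.
have Jp00 : 0 <= Jp 0 0.
  have := is_jacobian_on_row_ge0 (s := 1) Jpf Apx (Apray _ e00) rpx.
  rewrite mul1r -rowE mxE; apply.
  by near=> t; rewrite mul1r; apply: rp_ge0; near: t; exact: Apray.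
have Jm00 : Jm 0 0 <= 0.
  have := is_jacobian_on_row_ge0 (s := (-1)) Jmf Amx (Amray _ e00) rmx.
  rewrite mulN1r oppr_ge0 -rowE mxE; apply.
  by near=> t; rewrite mulN1r oppr_ge0; apply: rm_le0; near: t; exact: Amray.
have Gu := lorentzian_unitmx (metric_lorentzian (st_metric M) Xc cp).
have Gm := gm _ _ _ _ Xc De cp em Jmf.
have Gp := gp _ _ _ _ Xc De cp ep Jpf.
(* Both pullbacks now involve the same matrix, the components of [g] at the single glued point. *)
rewrite glue// in Gm.
have [JJ] := null_transversal_entry Gu Nn Nnull Gm Gp JmJp JpH.
by rewrite -JJ eq_le Jm00 JJ Jp00.
Unshelve. all: by end_near. Qed.
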